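(* For any constant $C \geq 1$ there exists a constant $c=c(C)>0$ such that, for any $d$-regular graph $G$ and $\varepsilon \leq c/\log^2 d$, we have \[ t_{\mathsf{cov}}^{\varepsilon\mathsf{TB}}(G) \geq Cn.\] In particular, if $\varepsilon = o(1/\log^2 d)$, where $d$ may depend on $n$, then \[ t_{\mathsf{cov}}^{\varepsilon\mathsf{TB}}(G) = \omega(n).\]
   Context: All graphs $G=(V,E)$ are finite, undirected, connected and have no multiple edges; $n=|V|$ denotes the number of vertices, $d\ge 2$ is the degree, and $\log$ is the natural logarithm. The bias $\varepsilon$ is a parameter in $[0,1]$. The asymptotic notation in the second assertion is as $n\to\infty$, for a sequence of $d$-regular graphs with $d=d(n)$ and $\varepsilon=\varepsilon(n)$; $\omega(n)$ means that the ratio to $n$ tends to infinity. The $\varepsilon$-time-biased random walk ($\varepsilon$-TBRW) is the following process $(X_t)_{t\ge0}$ on $V$: in each step, independently, with probability $1-\varepsilon$ the walk moves to a uniformly random neighbour of the current vertex, and with probability $\varepsilon$ it moves to a neighbour sampled from a probability distribution on the neighbours of the current vertex chosen by a controller, who has full knowledge of $G$; this distribution may depend on the whole history $X_0,\dots,X_t$. A strategy is a rule specifying these choices. $C_v^{\varepsilon\mathsf{TB}}(G)$ is the expected time for the $\varepsilon$-TBRW to visit every vertex of $G$ when started from $v$, minimized over all strategies, and $t_{\mathsf{cov}}^{\varepsilon\mathsf{TB}}(G)=\max_{v\in V}C_v^{\varepsilon\mathsf{TB}}(G)$.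
   Formalization: The first assertion is proved for all graphs with n ≥ n0, where n0 depends only on C; as printed, for every n, it fails: the triangle (d = 2, n = 3) with ε = 0 has cover time 3 < 6 = Cn for C = 2. *)

(* Defs.v *)
From HB Require Import structures.
From mathcomp Require Import all_boot all_order all_algebra.
From mathcomp Require Import all_classical all_reals all_analysis.

Set Implicit Arguments.
Unset Strict Implicit.
Unset Printing Implicit Defensive.

Import Order.TTheory GRing.Theory Num.Theory.
Import numFieldNormedType.Exports.

Local Open Scope classical_set_scope.
Local Open Scope ring_scope.

Record graph := Graph {
  vertex :> finType;
  adj : rel vertex;
  adj_sym : symmetric adj;
  adj_irr : irreflexive adj;
  graph_nonempty : (0 < #|vertex|)%N;
  graph_connected : forall u v : vertex, connect adj u v
}.

Definition degree (G : graph) (u : G) : nat := #|[pred w | adj u w]|.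

Definition regular (G : graph) (d : nat) : Prop := forall u : G, degree u = d.

(* A strategy reads the history X_0, ..., X_t (as a sequence, most recent
   vertex last) and returns the controller's distribution; its values on the
   empty sequence are irrelevant. *)
Definition is_strategy (R : realType) (G : graph) (sigma : seq G -> G -> R) :
    Prop :=
  forall (h : seq G) (u : G),
    [/\ forall w, 0 <= sigma (rcons h u) w,
        forall w, ~~ adj u w -> sigma (rcons h u) w = 0
      & \sum_(w : G) sigma (rcons h u) w = 1].

(* Probability that the walk with history h and current vertex u, the last
   entry of h, moves to w. *)
Definition tbrw_step (R : realType) (G : graph) (eps : R)
    (sigma : seq G -> G -> R) (h : seq G) (u w : G) : R :=
  (1 - eps) * (if adj u w then (degree u)%:R^-1 else 0) + eps * sigma h w.

(* The transition law is written multiplicatively, so that it says nothing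
   about trajectories of probability zero. *)
Definition is_tbrw (R : realType) (G : graph) (eps : R)
    (sigma : seq G -> G -> R) (v : G) (disp : measure_display)
    (T : measurableType disp) (P : probability T R) (X : nat -> T -> G) :
    Prop :=
  [/\ forall t u, measurable (X t @^-1` [set u]),
      P (X 0%N @^-1` [set v]) = 1%E
    & forall (t : nat) (x : nat -> G),
        P [set w | forall i, (i <= t.+1)%N -> X i w = x i] =
        (P [set w | forall i, (i <= t)%N -> X i w = x i] *
         (tbrw_step eps sigma (mkseq x t.+1) (x t) (x t.+1))%:E)%E].

(* +oo when the trajectory misses a vertex. *)
Definition cover_time (R : realType) (G : graph) (T : Type)
    (X : nat -> T -> G) (w : T) : \bar R :=
  ereal_inf [set (t%:R)%:E | t in
    [set t : nat | forall u : G, exists2 i, (i <= t)%N & X i w = u]].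

(* The infimum ranges over all strategies together with all walks following
   them; every strategy is followed by some walk, see tbrw_exists below. *)
Definition C_TB (R : realType) (G : graph) (eps : R) (v : G) : \bar R :=
  ereal_inf [set E : \bar R |
    exists (sigma : seq G -> G -> R) (disp : measure_display)
      (T : measurableType disp) (P : probability T R) (X : nat -> T -> G),
      [/\ is_strategy sigma, is_tbrw eps sigma v P X
        & E = (\int[P]_w cover_time R X w)%E]].

Definition tcov_TB (R : realType) (G : graph) (eps : R) : \bar R :=
  \big[maxe/-oo%E]_(v : G) C_TB eps v.

(* The rest of the file proves tbrw_exists, so that the infimum defining C_TB
   is not vacuous. The walk is built on [0, 1[ with Lebesgue measure: the
   interval of the points following a trajectory up to time t is subdivided
   according to the transition law into the intervals for time t+1. The pair
   cyl q x t is the left end and the length of the interval of trajectory x. *)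

Definition psum (R : realType) (G : graph) (f : G -> R) (k : nat) : R :=
  \sum_(w : G | (enum_rank w < k)%N) f w.

Definition slot (R : realType) (G : graph) (f : G -> R) (a p y : R) (w : G) :
    bool :=
  a + p * psum f (enum_rank w) <= y < a + p * psum f (enum_rank w).+1.

Lemma psumS (R : realType) (G : graph) (f : G -> R) (w : G) :
  psum f (enum_rank w).+1 = psum f (enum_rank w) + f w.
Proof.
rewrite /psum (bigD1 w) //= addrC; congr (_ + _); apply: eq_bigl => u.
by rewrite ltnS ltn_neqAle andbC -(inj_eq (@enum_rank_inj G)).
Qed.

Lemma psum_le (R : realType) (G : graph) (f : G -> R) (i j : nat) :
  (forall w, 0 <= f w) -> (i <= j)%N -> psum f i <= psum f j.
Proof.
move=> f0 ij; rewrite /psum big_mkcond [leRHS]big_mkcond /=.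
apply: ler_sum => w _; case: (ltnP (enum_rank w) i) => [wi|_].
  by rewrite (leq_trans wi ij).
by case: ifP.
Qed.

Lemma psum0 (R : realType) (G : graph) (f : G -> R) : psum f 0 = 0.
Proof. by rewrite /psum big_pred0. Qed.

Lemma psum_card (R : realType) (G : graph) (f : G -> R) :
  psum f #|G| = \sum_w f w.
Proof. by apply: eq_bigl => w; rewrite ltn_ord. Qed.

Lemma slot_exists (R : realType) (G : graph) (f : G -> R) (a p y : R) :
  (forall w, 0 <= f w) -> \sum_w f w = 1 -> a <= y < a + p ->
  exists w, slot f a p y w.
Proof.
move=> f0 f1 /andP[ay yp].
have ex : exists k, y < a + p * psum f k.
  by exists #|G|; rewrite psum_card f1 mulr1.
case: (ex_minnP ex) => -[|k] yk kmin.
  by move: yk; rewrite psum0 mulr0 addr0 ltNge ay.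
have kG : (k < #|G|)%N.
  by apply: kmin; rewrite psum_card f1 mulr1.
exists (enum_val (Ordinal kG)).
rewrite /slot enum_valK /= yk andbT leNgt.
by apply/negP => /kmin; rewrite ltnn.
Qed.

Lemma slot_uniq (R : realType) (G : graph) (f : G -> R) (a p y : R) (u w : G) :
  (forall w, 0 <= f w) -> 0 <= p -> slot f a p y u -> slot f a p y w -> u = w.
Proof.
move=> f0 p0.
have lt u1 u2 : (enum_rank u1 < enum_rank u2)%N ->
    slot f a p y u1 -> ~ slot f a p y u2.
  move=> u12 /andP[_ yu] /andP[uy _].
  suff : y < y by rewrite ltxx.
  apply: lt_le_trans yu (le_trans _ uy).
  by rewrite lerD2l ler_wpM2l // psum_le.
move=> su sw; apply: enum_rank_inj; apply: val_inj.
by case: (ltngtP (enum_rank u) (enum_rank w)) => // /lt; [move/(_ su sw)|move/(_ sw su)].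
Qed.

Fixpoint walk_state (R : realType) (G : graph) (q : seq G -> G -> R) (v : G)
    (y : R) (t : nat) : seq G * (R * R) :=
  if t is t'.+1 then
    let: (h, (a, p)) := walk_state q v y t' in
    let w := odflt v [pick w | slot (q h) a p y w] in
    (rcons h w, (a + p * psum (q h) (enum_rank w), p * q h w))
  else ([:: v], (0, 1)).

Definition walk (R : realType) (G : graph) (q : seq G -> G -> R) (v : G)
    (t : nat) (y : R) : G :=
  if 0 <= y < 1 then last v (walk_state q v y t).1 else v.

Fixpoint cyl (R : realType) (G : graph) (q : seq G -> G -> R) (x : nat -> G)
    (t : nat) : R * R :=
  if t is t'.+1 then
    let: (a, p) := cyl q x t' in
    let f := q (mkseq x t'.+1) in
    (a + p * psum f (enum_rank (x t)), p * f (x t))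
  else (0, 1).

Lemma cyl_ge0 (R : realType) (G : graph) (q : seq G -> G -> R) (x : nat -> G)
    (t : nat) :
  (forall h u w, 0 <= q (rcons h u) w) -> 0 <= (cyl q x t).2.
Proof.
move=> q0; elim: t => [|t IH] /=; first exact: ler01.
by move: IH; case: (cyl q x t) => a p /= p0; rewrite mulr_ge0 // mkseqS.
Qed.

Lemma walkP (R : realType) (G : graph) (q : seq G -> G -> R) (x : nat -> G)
    (y : R) (t : nat) :
  (forall h u w, 0 <= q (rcons h u) w) ->
  (forall h u, \sum_w q (rcons h u) w = 1) -> 0 <= y < 1 ->
  let: (a, p) := cyl q x t in
  ((forall i, (i <= t)%N -> walk q (x 0%N) i y = x i) <-> a <= y < a + p) /\
  (a <= y < a + p -> walk_state q (x 0%N) y t = (mkseq x t.+1, (a, p))).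
Proof.
move=> q0 q1 y01; elim: t => [|t] /=.
  rewrite add0r; split=> //; split=> // _ [|//] _.
  by rewrite /walk y01.
have := cyl_ge0 x t q0; case: (cyl q x t) => a p /= p0 [IH1 IH2].
set f := q (mkseq x t.+1); set z := x t.+1.
have f0 w : 0 <= f w by rewrite /f mkseqS.
have f1 : \sum_w f w = 1 by rewrite /f mkseqS.
have slotE : (a + p * psum f (enum_rank z) <= y <
    a + p * psum f (enum_rank z) + p * f z) = slot f a p y z.
  by rewrite /slot psumS mulrDr addrA.
rewrite slotE.
have nest : slot f a p y z -> a <= y < a + p.
  move=> /andP[h1 h2]; apply/andP; split.
    by apply: le_trans h1; rewrite lerDl mulr_ge0 // -(psum0 f) psum_le.
  apply: lt_le_trans h2 _; rewrite lerD2l ler_piMr // -f1 -psum_card.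
  by rewrite psum_le.
have pickE : a <= y < a + p -> exists2 w,
    slot f a p y w & walk_state q (x 0%N) y t.+1 =
      (rcons (mkseq x t.+1) w, (a + p * psum f (enum_rank w), p * f w)).
  move=> ay; rewrite /= IH2 //= -/f.
  have [w0 sw0] := slot_exists f0 f1 ay.
  by case: pickP => [w sw|/(_ w0)]; [exists w|rewrite sw0].
split; [split|].
- move=> H; have ay : a <= y < a + p.
    by apply/IH1 => i it; apply: H; rewrite (leq_trans it).
  have [w sw E] := pickE ay.
  have := H t.+1 (leqnn _); rewrite /walk y01 E last_rcons => wz.
  by rewrite /z -wz.
- move=> sz; have ay := nest sz; have [w sw E] := pickE ay.
  move=> i; rewrite leq_eqVlt => /predU1P[->|]; last first.
    by rewrite ltnS; move: i; apply/IH1.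
  by rewrite /walk y01 E last_rcons; exact: slot_uniq sw sz.
- move=> sz; have ay := nest sz; have [w sw E] := pickE ay.
  have wz : w = z by exact: slot_uniq sw sz.
  by rewrite -[LHS]/(walk_state q (x 0%N) y t.+1) E wz /z -mkseqS.
Qed.

Lemma tbrw_step_ge0 (R : realType) (G : graph) (eps : R)
    (sigma : seq G -> G -> R) (h : seq G) (u w : G) :
  is_strategy sigma -> 0 <= eps <= 1 ->
  0 <= tbrw_step eps sigma (rcons h u) u w.
Proof.
move=> /(_ h u)[s0 _ _] /andP[e0 e1].
rewrite /tbrw_step addr_ge0 ?mulr_ge0 ?subr_ge0 //.
by case: ifP => _; rewrite ?invr_ge0.
Qed.

Lemma tbrw_step_sum (R : realType) (G : graph) (eps : R)
    (sigma : seq G -> G -> R) (h : seq G) (u : G) :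
  is_strategy sigma -> \sum_w tbrw_step eps sigma (rcons h u) u w = 1.
Proof.
move=> /(_ h u)[s0 sa s1].
rewrite /tbrw_step big_split /= -!mulr_sumr s1 mulr1 -big_mkcond /=.
rewrite sumr_const -/(degree u) -[X in _ * X]mulr_natr mulVf ?mulr1 ?subrK //.
rewrite pnatr_eq0 -lt0n /degree; apply/card_gt0P.
have [w uw|nw] := pickP (adj u); first by exists w.
have := oner_neq0 R; rewrite -s1 big1 ?eqxx // => w _.
by rewrite sa // nw.
Qed.

Lemma uniform01_itv (R : realType) (A : set R) (a p : R) :
  measurable A -> 0 <= a -> 0 <= p -> a + p <= 1 ->
  A `&` `[0, 1[ = `[a, (a + p)[%classic ->
  uniform_prob (@ltr01 R) A = p%:E.
Proof.
move=> mA a0 p0 ap1 AE.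
rewrite /uniform_prob integral_uniform_pdf.
rewrite (eq_integral (fun=> 1%E)); last first.
  move=> x; rewrite inE /= in_itv /= => -[_ x01].
  by rewrite /uniform_pdf x01 subr0 invr1.
rewrite integral_cst /= ?mul1e; last exact: measurableI.
have -> : A `&` `[0, 1] = `[a, (a + p)[%classic `|` (A `&` [set 1]).
  rewrite -AE -setIUr; congr (_ `&` _); apply/seteqP; split=> y /=.
    rewrite !in_itv /= => /andP[-> ]; rewrite le_eqVlt => /orP[/eqP|].
      by right.
    by left.
  rewrite !in_itv /= => -[/andP[-> /ltW ->]//|->].
  by rewrite ler01 lexx.
rewrite measureU0 //=; first last.
- apply/eqP; rewrite eq_le measure_ge0 andbT.
  rewrite -(lebesgue_measure_set1 (1 : R)); apply: le_measure; rewrite ?inE //.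
  exact: measurableI.
- exact: measurableI.
rewrite lebesgue_measure_itv /= lte_fin ltrDl.
case: ltP => [_|p0']; first by rewrite -EFinD addrAC subrr add0r.
by congr (_%:E); apply/eqP; rewrite eq_le p0 p0'.
Qed.

Lemma cyl_bounds (R : realType) (G : graph) (q : seq G -> G -> R)
    (x : nat -> G) (t : nat) :
  (forall h u w, 0 <= q (rcons h u) w) ->
  (forall h u, \sum_w q (rcons h u) w = 1) ->
  0 <= (cyl q x t).1 /\ (cyl q x t).1 + (cyl q x t).2 <= 1.
Proof.
move=> q0 q1; elim: t => [|t] /=; first by rewrite add0r.
have := cyl_ge0 x t q0; case: (cyl q x t) => a p /= p0 [a0 ap1].
set f := q (mkseq x t.+1); set z := x t.+1.
have f0 w : 0 <= f w by rewrite /f mkseqS.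
have f1 : \sum_w f w = 1 by rewrite /f mkseqS.
split; first by rewrite addr_ge0 // mulr_ge0 // -(psum0 f) psum_le.
rewrite -addrA -mulrDr -psumS (le_trans _ ap1) // lerD2l ler_piMr //.
by rewrite -f1 -psum_card psum_le.
Qed.

Lemma tbrw_exists (R : realType) (G : graph) (eps : R)
    (sigma : seq G -> G -> R) (v : G) :
  is_strategy sigma -> 0 <= eps <= 1 ->
  exists (disp : measure_display) (T : measurableType disp)
    (P : probability T R) (X : nat -> T -> G), is_tbrw eps sigma v P X.
Proof.
move=> ssigma eps01.
pose q (h : seq G) := tbrw_step eps sigma h (last v h).
have q0 h u w : 0 <= q (rcons h u) w by rewrite /q last_rcons tbrw_step_ge0.
have q1 h u : \sum_w q (rcons h u) w = 1.
  by rewrite /q last_rcons tbrw_step_sum.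
exists _, (measurableTypeR R), (uniform_prob (@ltr01 R)), (walk q v).
pose A x t := [set y : R | forall i, (i <= t)%N -> walk q v i y = x i].
have AI x t : x 0%N = v ->
    A x t `&` `[0, 1[ = `[(cyl q x t).1, ((cyl q x t).1 + (cyl q x t).2)[%classic.
  move=> x0; have := cyl_bounds x t q0 q1.
  case E : (cyl q x t) => [a p] /= [a0 ap1].
  apply/seteqP; split=> y /=; rewrite !in_itv /=.
    move=> [Ay y01]; have := walkP x t q0 q1 y01; rewrite E x0 => -[H _].
    exact/H.
  move=> ay; have y01 : 0 <= y < 1.
    case/andP: ay => a1 a2; rewrite (le_trans a0 a1) /=.
    exact: lt_le_trans ap1.
  split=> //; have := walkP x t q0 q1 y01; rewrite E x0 => -[H _].
  exact/H.
have A0 x t : x 0%N != v -> A x t = set0.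
  move=> x0; rewrite -subset0 => y /(_ 0%N isT); rewrite /walk /=.
  by move=> E; move: x0; rewrite -E; case: ifP; rewrite eqxx.
have mA x t : measurable (A x t).
  have [x0|/A0->//] := eqVneq (x 0%N) v.
  rewrite -(setIT (A x t)) -(setUv `[0, 1[%classic) setIUr AI //.
  apply: measurableU; first exact: measurable_itv.
  have [xv|xv] := pselect (forall i, (i <= t)%N -> x i = v).
    suff -> : A x t `&` ~` `[0, 1[ = ~` `[0, 1[%classic by exact: measurableC.
    apply/seteqP; split=> y /=; first by case.
    rewrite in_itv /= => /negP /negbTE y01; split; last by rewrite y01.
    by move=> i it; rewrite /walk y01 xv.
  suff -> : A x t `&` ~` `[0, 1[ = set0 by [].
  rewrite -subset0 => y [Ay]; rewrite /= in_itv /= => /negP /negbTE y01.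
  by apply: xv => i it; rewrite -Ay // /walk y01.
have PA x t : x 0%N = v -> uniform_prob (@ltr01 R) (A x t) = (cyl q x t).2%:E.
  move=> x0; have [a0 ap1] := cyl_bounds x t q0 q1.
  exact: (uniform01_itv (mA _ _) a0 (cyl_ge0 x t q0) ap1 (AI _ _ x0)).
have mQ (Q : Prop) : measurable ([set _ | Q] : set (measurableTypeR R)).
  have [HQ|HQ] := pselect Q.
    by rewrite (_ : mkset _ = setT) //; apply/seteqP; split.
  by rewrite (_ : mkset _ = set0) //; apply/seteqP; split.
split.
- move=> t u.
  have -> : walk q v t @^-1` [set u] =
      \bigcup_(s : t.+1.-tuple G) (A (nth v s) t `&` [set _ | nth v s t = u]).
    apply/seteqP; split=> y /=.
      move=> yu; exists (mktuple (fun i : 'I_t.+1 => walk q v i y)) => //=.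
      have E i : (i <= t)%N ->
          nth v (mktuple (fun i : 'I_t.+1 => walk q v i y)) i = walk q v i y.
        move=> it; exact: (nth_mktuple (fun i : 'I_t.+1 => walk q v i y) v
            (Ordinal (it : (i < t.+1)%N))).
      by split=> [i it|]; rewrite E.
    by move=> [s _ [As <-]]; apply: As.
  apply: countable_bigcupT_measurable => // s.
  exact: (measurableI _ _ (mA _ _) (mQ _)).
- have := PA (fun=> v) 0%N erefl; rewrite /= => <-; congr (uniform_prob _ _).
  apply/seteqP; split=> y /=; last exact.
  by move=> yv [|//] _.
- move=> t x; rewrite -!/(A x _).
  have [x0|x0] := eqVneq (x 0%N) v; last by rewrite !A0 // measure0 mul0e.
  rewrite [LHS](PA x t.+1 x0) [X in (X * _)%E](PA x t x0) /=; case: (cyl q x t) => a p /=; rewrite -EFinM /q.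
  by rewrite [in last v _]mkseqS last_rcons.
Qed.

(* Main.v *)
Require Import Defs.
From HB Require Import structures.
From mathcomp Require Import all_boot all_order all_algebra.
From mathcomp Require Import all_classical all_reals all_analysis.
From mathcomp Require Import measurable_realfun.
From mathcomp Require Import zify ring lra.

Set Implicit Arguments.
Unset Strict Implicit.
Unset Printing Implicit Defensive.

Import Order.TTheory GRing.Theory Num.Theory.
Import numFieldNormedType.Exports.

Local Open Scope classical_set_scope.
Local Open Scope ring_scope.

(** The walk is compared with the simple random walk through a potential that
    sees J dyadic time scales at once.

    For a set U and a discount z < 1 let h_U(x) be the discounted time that the
    simple random walk from x needs to meet U, a truncation of the expected
    hitting time at 1 / (1 - z). The kernel of the simple random walk on a
    regular graph is symmetric, and Green's identity gives, for v in U and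
    U' = U minus v,

      sum over x of (h_U'(x) - h_U(x)) <= h_U'(v) ^ 2     (sum_htime_setD1).

    Take 1 - z = 2^-j for j < J and let the energy of U be the sum over j of
    n - 2^-j * (sum over x of h_U(x)). It equals J n for the full vertex set and
    0 for the empty one, and when v is removed it drops by at most the sum of
    h_U'(v)^2 / 2^j, which is at most 6 times h_U'(v) at the top scale, since
    the terms of this sum form a geometric series on each side of their peak
    (dyadic_sum_le, energy_setD1). So the walk, having just discovered v, needs
    a time of at least a sixth of the energy lost to meet the rest of U.
    Summing over the vertices in the order of their discovery, in any order,
    yields J n / 6: as in the coupon collector problem, each of the J scales
    contributes a time of order n.

    The controller interferes only slightly. The truncated hitting times are at
    most 2^J, so a step biased with probability eps spoils the argument by at
    most eps 2^J, which is at most 1 for eps <= 2^-J (potential_step). The bound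
    eps <= c / (ln d)^2 implies this, because ln d >= ln 2. Hence the expected
    cover time is at least (J n / 6 - 2^J) / 4 (C_TB_ge), the factor 4 absorbing
    the biased steps and the fact that only finitely many steps are examined.
    Choosing J large in terms of C proves the first assertion; the second
    follows by applying the first with every C. *)

(** * Averages with respect to a symmetric stochastic kernel *)

Definition sym_stochastic (R : realType) (V : finType) (p : V -> V -> R) :
    Prop :=
  [/\ forall x y, 0 <= p x y, forall x y, p x y = p y x
    & forall x, \sum_y p x y = 1].

Definition avg (R : realType) (V : finType) (p : V -> V -> R) (f : V -> R)
    (x : V) : R :=
  \sum_y p x y * f y.

Lemma avg_le (R : realType) (V : finType) (p : V -> V -> R) (f g : V -> R)
    (x : V) :
  sym_stochastic p -> (forall y, f y <= g y) -> avg p f x <= avg p g x.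
Proof. by move=> [p0 _ _] fg; apply: ler_sum => y _; apply: ler_wpM2l. Qed.

Lemma avg_cst (R : realType) (V : finType) (p : V -> V -> R) (c : R) (x : V) :
  sym_stochastic p -> avg p (fun=> c) x = c.
Proof. by move=> [_ _ p1]; rewrite /avg -mulr_suml p1 mul1r. Qed.

Lemma avgB (R : realType) (V : finType) (p : V -> V -> R) (f g : V -> R)
    (x : V) :
  avg p (fun y => f y - g y) x = avg p f x - avg p g x.
Proof. by rewrite /avg -sumrB; apply: eq_bigr => y _; rewrite mulrBr. Qed.

(** Self-adjointness of the averaging operator: reversibility of the walk with
    respect to the uniform measure. *)
Lemma avg_sym (R : realType) (V : finType) (p : V -> V -> R) (f g : V -> R) :
  sym_stochastic p ->
  \sum_x f x * avg p g x = \sum_x g x * avg p f x.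
Proof.
move=> [_ pC _]; rewrite /avg.
under eq_bigr do rewrite mulr_sumr.
under [RHS]eq_bigr do rewrite mulr_sumr.
rewrite exchange_big; apply: eq_bigr => y _; apply: eq_bigr => x _.
by rewrite pC; ring.
Qed.

(** At a point where f is largest and positive, f <= z p f <= z f < f would
    follow. Every comparison between hitting times below is an instance. *)
Lemma maximum_principle (R : realType) (V : finType) (p : V -> V -> R) (z : R)
    (f : V -> R) :
  sym_stochastic p -> 0 <= z < 1 ->
  (forall x, 0 < f x -> f x <= z * avg p f x) -> forall x, f x <= 0.
Proof.
move=> sp /andP[z0 z1] H x0.
case: (@arg_maxP _ R V x0 xpredT f isT) => x _ fx.
rewrite leNgt; apply/negP => f0.
have fxp : 0 < f x by apply: lt_le_trans f0 (fx _ _).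
have : f x <= z * f x.
  apply: le_trans (H _ fxp) _; apply: ler_wpM2l => //.
  by rewrite -[leRHS](avg_cst (f x) x sp); apply: avg_le => // y; exact: fx.
by rewrite leNgt gtr_pMl // z1.
Qed.

(** * Discounted hitting times *)

(** The sum over t < m of z ^ t times the probability that the walk started
    at x has not met U at time t. *)
Fixpoint htime_upto (R : realType) (V : finType) (p : V -> V -> R) (z : R)
    (U : {set V}) (m : nat) (x : V) : R :=
  if m is m'.+1 then
    if x \in U then 0 else 1 + z * avg p (htime_upto p z U m') x
  else 0.

(** With T the time at which the walk from x first meets U, this is the
    expectation of 1 + z + ... + z ^ (T - 1): a truncation of the expected
    hitting time at the scale 1 / (1 - z), finite even for empty U. *)
Definition htime (R : realType) (V : finType) (p : V -> V -> R) (z : R)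
    (U : {set V}) (x : V) : R :=
  limn (fun m => htime_upto p z U m x).

Lemma htime_upto_ge0 (R : realType) (V : finType) (p : V -> V -> R) (z : R)
    (U : {set V}) (m : nat) (x : V) :
  sym_stochastic p -> 0 <= z -> 0 <= htime_upto p z U m x.
Proof.
move=> sp z0; elim: m x => [|m IH] x //=; case: ifP => // _.
rewrite addr_ge0 ?mulr_ge0 // -(avg_cst 0 x sp); exact: avg_le.
Qed.

Lemma htime_upto_nd (R : realType) (V : finType) (p : V -> V -> R) (z : R)
    (U : {set V}) (m : nat) (x : V) :
  sym_stochastic p -> 0 <= z ->
  htime_upto p z U m x <= htime_upto p z U m.+1 x.
Proof.
move=> sp z0; elim: m x => [|m IH] x; first exact: htime_upto_ge0.
rewrite [leRHS]/= [leLHS]/=; case: ifP => // _.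
by rewrite lerD2l ler_wpM2l //; apply: avg_le => // y; exact: IH.
Qed.

Lemma htime_upto_le (R : realType) (V : finType) (p : V -> V -> R) (z : R)
    (U : {set V}) (m : nat) (x : V) :
  sym_stochastic p -> 0 <= z < 1 -> htime_upto p z U m x <= (1 - z)^-1.
Proof.
move=> sp /andP[z0 z1].
have k0 : 0 < 1 - z by rewrite subr_gt0.
elim: m x => [|m IH] x /=; first by rewrite invr_ge0 ltW.
case: ifP => _; first by rewrite invr_ge0 ltW.
have -> : (1 - z)^-1 = 1 + z * (1 - z)^-1 :> R by field; lra.
rewrite lerD2l ler_wpM2l // -[leRHS](avg_cst _ x sp).
exact: avg_le.
Qed.

Lemma cvg_htime (R : realType) (V : finType) (p : V -> V -> R) (z : R)
    (U : {set V}) (x : V) :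
  sym_stochastic p -> 0 <= z < 1 ->
  htime_upto p z U m x @[m --> \oo] --> htime p z U x.
Proof.
move=> sp z01; apply: nondecreasing_is_cvgn.
  apply/nondecreasing_seqP => m.
  by apply: htime_upto_nd => //; case/andP: z01.
by exists (1 - z)^-1 => _ [m _ <-]; exact: htime_upto_le.
Qed.

Lemma htime_in (R : realType) (V : finType) (p : V -> V -> R) (z : R)
    (U : {set V}) (x : V) :
  sym_stochastic p -> 0 <= z < 1 -> x \in U -> htime p z U x = 0.
Proof.
move=> sp z01 xU; apply/cvg_lim => //; rewrite -cvg_shiftS /= xU.
exact: cvg_cst.
Qed.

Lemma htime_out (R : realType) (V : finType) (p : V -> V -> R) (z : R)
    (U : {set V}) (x : V) :
  sym_stochastic p -> 0 <= z < 1 -> x \notin U ->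
  htime p z U x = 1 + z * avg p (htime p z U) x.
Proof.
move=> sp z01 /negbTE xU; apply/cvg_lim => //; rewrite -cvg_shiftS /= xU.
apply: cvgD; first exact: cvg_cst.
apply: cvgM; first exact: cvg_cst.
rewrite /avg; apply: cvg_big => [|y _]; first exact: add_continuous.
by apply: cvgM; [exact: cvg_cst|exact: cvg_htime].
Qed.

Lemma htime_ge0 (R : realType) (V : finType) (p : V -> V -> R) (z : R)
    (U : {set V}) (x : V) :
  sym_stochastic p -> 0 <= z < 1 -> 0 <= htime p z U x.
Proof.
move=> sp z01; have /andP[z0 z1] := z01.
apply: limr_ge; first by apply/cvg_ex; eexists; exact: cvg_htime.
by apply: nearW => m; exact: htime_upto_ge0.
Qed.

Lemma htime_le (R : realType) (V : finType) (p : V -> V -> R) (z : R)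
    (U : {set V}) (x : V) :
  sym_stochastic p -> 0 <= z < 1 -> htime p z U x <= (1 - z)^-1.
Proof.
move=> sp z01.
apply: limr_le; first by apply/cvg_ex; eexists; exact: cvg_htime.
by apply: nearW => m; exact: htime_upto_le.
Qed.

Lemma htime_antitone (R : realType) (V : finType) (p : V -> V -> R) (z : R)
    (U U' : {set V}) (x : V) :
  sym_stochastic p -> 0 <= z < 1 -> U' \subset U ->
  htime p z U x <= htime p z U' x.
Proof.
move=> sp z01 /fintype.subsetP U'U; rewrite -subr_le0; move: x.
apply: (maximum_principle sp z01) => x.
have [xU|xU _] := boolP (x \in U).
  by rewrite (htime_in sp z01 xU) sub0r oppr_gt0 ltNge htime_ge0.
rewrite avgB !htime_out //; first by rewrite le_eqVlt; apply/orP; left; apply/eqP; ring.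
by apply: contra xU => /U'U.
Qed.

Lemma htime_discount (R : realType) (V : finType) (p : V -> V -> R) (z z' : R)
    (U : {set V}) (x : V) :
  sym_stochastic p -> 0 <= z -> z <= z' -> z' < 1 ->
  htime p z U x <= htime p z' U x.
Proof.
move=> sp z0 zz' z1.
have z01 : 0 <= z < 1 by rewrite z0 (le_lt_trans zz').
have z01' : 0 <= z' < 1 by rewrite z1 (le_trans z0).
rewrite -subr_le0; move: x; apply: (maximum_principle sp z01) => x.
have [xU|xU _] := boolP (x \in U); first by rewrite !htime_in // subrr ltxx.
rewrite avgB !htime_out //.
have : 0 <= avg p (htime p z' U) x.
  by rewrite -(avg_cst 0 x sp); apply: avg_le => // y; exact: htime_ge0.
nra.
Qed.

Lemma htime_step_ge (R : realType) (V : finType) (p : V -> V -> R) (z : R)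
    (U : {set V}) (x : V) :
  sym_stochastic p -> 0 <= z < 1 -> x \notin U ->
  htime p z U x - 1 <= avg p (htime p z U) x.
Proof.
move=> sp z01 xU; have /andP[z0 z1] := z01.
rewrite [htime p z U x]htime_out // addrAC subrr add0r ler_piMl ?(ltW z1) //.
by rewrite -(avg_cst 0 x sp); apply: avg_le => // y; exact: htime_ge0.
Qed.

(** The inequality on which everything rests. Put D for the summand and h' for
    the hitting time of U minus v. Then D vanishes on U minus v, and
    (1 - z p) D vanishes outside U, whereas (1 - z p) h' is 1 outside U minus
    v. Green's identity turns the sum of D = D * (1 - z p) h' into the sum of
    h' * (1 - z p) D, whose only nonzero term is the one at v; there D equals
    h', and (1 - z p) D is at most D because D is nonnegative. *)
Lemma sum_htime_setD1 (R : realType) (V : finType) (p : V -> V -> R) (z : R)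
    (U : {set V}) (v : V) :
  sym_stochastic p -> 0 <= z < 1 -> v \in U ->
  \sum_x (htime p z (U :\ v) x - htime p z U x) <= htime p z (U :\ v) v ^+ 2.
Proof.
move=> sp z01 vU; have /andP[z0 z1] := z01.
set h' := htime p z (U :\ v); set h := htime p z U.
pose D x := h' x - h x.
have D0 x : 0 <= D x by rewrite subr_ge0 htime_antitone // subsetDl.
have Din x : x \in U :\ v -> D x = 0.
  move=> xU; have : x \in U by move: xU; rewrite inE => /andP[].
  by move=> xU'; rewrite /D /h /h' !htime_in // subrr.
have Dout x : x \notin U -> D x = z * avg p D x.
  move=> xU; rewrite avgB /D /h' /h !htime_out //; first by ring.
  by apply: contra xU; rewrite inE => /andP[].
(* Green's identity for the symmetric operator 1 - z p *)
have -> : \sum_x D x = \sum_x h' x * (D x - z * avg p D x).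
  transitivity (\sum_x D x * (h' x - z * avg p h' x)).
    apply: eq_bigr => x _; have [xU|xU] := boolP (x \in U :\ v).
      by rewrite Din // mul0r.
    by rewrite {1}/h' htime_out // -/h'; ring.
  rewrite (eq_bigr (fun x => h' x * D x - z * (D x * avg p h' x))); last first.
    by move=> x _; ring.
  rewrite [RHS](eq_bigr (fun x => h' x * D x - z * (h' x * avg p D x))).
    by rewrite !sumrB -!mulr_sumr (avg_sym D h' sp).
  by move=> x _; ring.
rewrite (bigD1 v) //= big1 ?addr0; last first.
  move=> x xv; have [xU|xU] := boolP (x \in U).
    by rewrite /h' htime_in ?mul0r // !inE xv.
  by rewrite -Dout // subrr mulr0.
have -> : D v = h' v by rewrite /D /h htime_in // subr0.
rewrite expr2 ler_wpM2l //; first exact: htime_ge0.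
rewrite gerBl mulr_ge0 // -(avg_cst 0 v sp); exact: avg_le.
Qed.

(** * The energy of a set over dyadic scales *)

(** Each term is at most min(H, 2^j)^2 / 2^j, so the terms grow geometrically
    up to the scale 2^j = H and decay geometrically from there on: one hitting
    time of size H is charged O(H) by all the scales together. *)
Lemma dyadic_sum_le (R : realType) (J : nat) (H : R) (a : nat -> R) :
  0 <= H -> (forall j, (j < J)%N -> [/\ 0 <= a j, a j <= H & a j <= 2 ^+ j]) ->
  \sum_(j < J) a j ^+ 2 / 2 ^+ j <= 6 * H.
Proof.
move=> H0 aP.
(* The function Y / (Y + H) grows by Y H / ((2 Y + H) (Y + H)) from Y to 2 Y,
   which is at least min(H, Y)^2 / (6 H Y): the bound telescopes. *)
suff : \sum_(j < J) a j ^+ 2 / 2 ^+ j <= 6 * H * (2 ^+ J / (2 ^+ J + H)).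
  move=> /le_trans; apply; rewrite ler_piMr ?mulr_ge0 //.
  by rewrite ler_pdivrMr ?mul1r ?lerDl // ltr_wpDr ?exprn_gt0.
elim: J aP => [|J IH] aP; first by rewrite big_ord0 !mulr_ge0 ?invr_ge0 ?addr_ge0.
rewrite big_ord_recr /=.
have /IH S : forall j, (j < J)%N -> [/\ 0 <= a j, a j <= H & a j <= 2 ^+ j].
  by move=> j jJ; apply: aP; apply: ltnW.
have [a0 aH aY] := aP J (ltnSn J).
apply: le_trans (lerD S (lexx _)) _.
have : 0 < 2 ^+ J :> R by rewrite exprn_gt0.
rewrite (exprS 2 J); move: (2 ^+ J) aY => Y aY Y0.
rewrite -lerBrDl.
have -> : 6 * H * (2 * Y / (2 * Y + H)) - 6 * H * (Y / (Y + H)) =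
    (6 * H ^+ 2 * Y) / ((2 * Y + H) * (Y + H)) by field; lra.
rewrite ler_pdivrMr // mulrAC ler_pdivlMr; last by rewrite mulr_gt0; lra.
have [HY|YH] := leP H Y.
  have aa : a J ^+ 2 <= H ^+ 2 by rewrite ler_sqr ?nnegrE.
  have H2 : 0 <= H ^+ 2 by rewrite exprn_ge0.
  apply: (@le_trans _ _ (H ^+ 2 * ((2 * Y + H) * (Y + H)))).
    by rewrite ler_wpM2r // mulr_ge0; lra.
  have -> : 6 * H ^+ 2 * Y * Y = H ^+ 2 * (6 * Y * Y) by ring.
  by rewrite ler_wpM2l //; nra.
have aa : a J ^+ 2 <= Y ^+ 2 by rewrite ler_sqr ?nnegrE // ltW.
have Y2 : 0 <= Y ^+ 2 by rewrite exprn_ge0 // ltW.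
apply: (@le_trans _ _ (Y ^+ 2 * ((2 * Y + H) * (Y + H)))).
  by rewrite ler_wpM2r // mulr_ge0; lra.
have -> : 6 * H ^+ 2 * Y * Y = Y ^+ 2 * (6 * H * H) by ring.
by rewrite ler_wpM2l //; nra.
Qed.

(** The discount factor for which 1 / (1 - z), the largest possible discounted
    hitting time, is 2 ^ j. *)
Definition discount (R : realType) (j : nat) : R := 1 - (2 ^+ j)^-1.

Lemma discount_itv (R : realType) (j : nat) : 0 <= discount R j < 1.
Proof.
have Y0 : 1 <= 2 ^+ j :> R by rewrite exprn_ege1 // ler1n.
rewrite /discount subr_ge0 invf_le1 ?Y0 /=; last lra.
by rewrite gtrBl invr_gt0; lra.
Qed.

Lemma discount_inv (R : realType) (j : nat) : (1 - discount R j)^-1 = 2 ^+ j.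
Proof. by rewrite /discount opprB addrC subrK invrK. Qed.

Lemma discount_le (R : realType) (i j : nat) :
  (i <= j)%N -> discount R i <= discount R j.
Proof.
move=> ij; rewrite lerD2l lerN2 lef_pV2 ?posrE ?exprn_gt0 //.
by rewrite ler_weXn2l // ler1n.
Qed.

(** The j-th term is the expected number of starting points, among all the
    vertices, from which the walk killed at rate s = 2^-j meets U in its
    lifetime: s times the hitting time is the probability of being killed
    before meeting U. Equivalently it is the capacity of U for the killed walk
    divided by s. Dividing by s is what gives all scales equal weight: each of
    the J terms decreases from #|V| to 0 while U is exhausted. *)
Definition energy (R : realType) (V : finType) (p : V -> V -> R) (J : nat)
    (U : {set V}) : R :=
  \sum_(j < J) (#|V|%:R - (2 ^+ j)^-1 * \sum_x htime p (discount R j) U x).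

Lemma energy_setT (R : realType) (V : finType) (p : V -> V -> R) (J : nat) :
  sym_stochastic p -> energy p J [set: V] = J%:R * #|V|%:R.
Proof.
move=> sp; rewrite /energy (eq_bigr (fun=> #|V|%:R)) => [|j _].
  by rewrite sumr_const card_ord mulr_natl.
by rewrite big1 ?mulr0 ?subr0 // => x _; rewrite htime_in ?discount_itv ?inE.
Qed.

Lemma energy_ge0 (R : realType) (V : finType) (p : V -> V -> R) (J : nat)
    (U : {set V}) :
  sym_stochastic p -> 0 <= energy p J U.
Proof.
move=> sp; apply: sumr_ge0 => j _.
rewrite subr_ge0 mulrC ler_pdivrMr ?exprn_gt0 // mulr_natl -sumr_const.
apply: ler_sum => x _; rewrite -discount_inv.
by apply: htime_le; rewrite ?discount_itv.
Qed.

Lemma energy_le (R : realType) (V : finType) (p : V -> V -> R) (J : nat)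
    (U : {set V}) :
  sym_stochastic p -> energy p J U <= J%:R * #|V|%:R.
Proof.
move=> sp; rewrite -(energy_setT J sp); apply: ler_sum => j _.
rewrite lerD2l lerN2 ler_wpM2l ?invr_ge0 ?exprn_ge0 //.
by apply: ler_sum => x _; apply: htime_antitone; rewrite ?discount_itv ?finset.subsetT.
Qed.

Lemma energy_set0 (R : realType) (V : finType) (p : V -> V -> R) (J : nat) :
  sym_stochastic p -> energy p J finset.set0 <= 0.
Proof.
move=> sp; rewrite -oppr_ge0 -sumrN; apply: sumr_ge0 => j _.
have dj := discount_itv R j; have /andP[d0 d1] := dj.
rewrite opprB subr_ge0 mulrC ler_pdivlMr ?exprn_gt0 // mulr_natl -sumr_const.
apply: ler_sum => x _; rewrite -discount_inv -subr_le0; move: x.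
apply: (maximum_principle sp dj) => x _.
rewrite avgB avg_cst // htime_out ?inE // le_eqVlt; apply/orP; left; apply/eqP.
by field; lra.
Qed.

(** Visiting v costs energy, and this bounds the loss by the time that the walk
    then needs to meet the rest of U, whatever the order in which the vertices
    are visited. At scale j the loss is at most the square of the discounted
    hitting time at that scale divided by 2 ^ j, and the dyadic sum applies. *)
Lemma energy_setD1 (R : realType) (V : finType) (p : V -> V -> R) (J : nat)
    (U : {set V}) (v : V) :
  sym_stochastic p -> v \in U ->
  energy p J U <= energy p J (U :\ v) + 6 * htime p (discount R J) (U :\ v) v.
Proof.
move=> sp vU; rewrite -lerBlDl /energy -sumrB.
apply: le_trans (@dyadic_sum_le R J _
    (fun j => htime p (discount R j) (U :\ v) v) _ _); last 2 first.
- by apply: htime_ge0; rewrite ?discount_itv.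
- move=> j jJ; have /andP[d0 _] := discount_itv R j.
  have /andP[_ d1] := discount_itv R J.
  split; first by apply: htime_ge0; rewrite ?discount_itv.
    by apply: htime_discount => //; exact/discount_le/ltnW.
  by rewrite -discount_inv htime_le ?discount_itv.
apply: ler_sum => j _.
rewrite [leLHS](_ : _ = (\sum_x (htime p (discount R j) (U :\ v) x -
  htime p (discount R j) U x)) / 2 ^+ j); last by rewrite sumrB; ring.
rewrite ler_wpM2r ?invr_ge0 ?exprn_ge0 //.
by apply: sum_htime_setD1; rewrite ?discount_itv.
Qed.

(** A lower bound, up to the additive constant 2 ^ J, for the expected time that
    the simple random walk at x needs to cover the unvisited set U: the time
    until it meets U, plus the time for which the energy of U will be charged
    afterwards. *)
Definition potential (R : realType) (V : finType) (p : V -> V -> R) (J : nat)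
    (U : {set V}) (x : V) : R :=
  htime p (discount R J) U x + energy p J U / 6.

Lemma potential_le (R : realType) (V : finType) (p : V -> V -> R) (J : nat)
    (U : {set V}) (x : V) :
  sym_stochastic p -> potential p J U x <= 2 ^+ J + J%:R * #|V|%:R.
Proof.
move=> sp; apply: lerD.
  by rewrite -discount_inv htime_le ?discount_itv.
by have := energy_ge0 J U sp; have := energy_le J U sp; lra.
Qed.

(** Both cases of a step are combined here: when y is unvisited, the drop of
    the energy is paid for by the hitting time that starts afresh at y. *)
Lemma potential_setD1 (R : realType) (V : finType) (p : V -> V -> R) (J : nat)
    (U : {set V}) (y : V) :
  sym_stochastic p ->
  htime p (discount R J) U y + energy p J U / 6 <= potential p J (U :\ y) y.
Proof.
move=> sp; have [yU|yU] := boolP (y \in U).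
  rewrite htime_in ?discount_itv // add0r /potential.
  by have := energy_setD1 J sp yU; lra.
suff -> : U :\ y = U by [].
by apply/setP => x; rewrite !inE; case: eqVneq => // ->; rewrite (negbTE yU).
Qed.

(** A step of the simple random walk lowers the discounted hitting time by at
    most 1 on average. A step of the controller, taken with probability eps,
    can lower it by at most its largest value 2 ^ J. *)
Lemma potential_step (R : realType) (V : finType) (p : V -> V -> R) (J : nat)
    (eps : R) (s : V -> R) (U : {set V}) (x : V) :
  sym_stochastic p -> 0 <= eps <= 1 -> (forall y, 0 <= s y) ->
  \sum_y s y = 1 -> x \notin U ->
  potential p J U x - (1 + eps * 2 ^+ J) <=
  \sum_y ((1 - eps) * p x y + eps * s y) * potential p J (U :\ y) y.
Proof.
move=> sp /andP[e0 e1] s0 s1 xU; have [p0 _ p1] := sp.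
have dJ := discount_itv R J.
pose h := htime p (discount R J) U.
apply: (@le_trans _ _ (\sum_y ((1 - eps) * p x y + eps * s y) *
    (h y + energy p J U / 6))); last first.
  apply: ler_sum => y _; apply: ler_wpM2l; last exact: potential_setD1.
  by rewrite addr_ge0 ?mulr_ge0 ?subr_ge0.
have -> : \sum_y ((1 - eps) * p x y + eps * s y) * (h y + energy p J U / 6) =
    (1 - eps) * avg p h x + eps * \sum_y s y * h y + energy p J U / 6.
  rewrite (eq_bigr (fun y => (1 - eps) * (p x y * h y) + eps * (s y * h y) +
    ((1 - eps) * (energy p J U / 6) * p x y + eps * (energy p J U / 6) * s y))).
    by rewrite !big_split /= -!mulr_sumr p1 s1 -/(avg p h x); ring.
  by move=> y _; ring.
rewrite /potential -/h addrAC lerD2r.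
have h1 : h x - 1 <= avg p h x by apply: htime_step_ge.
have h2 : h x <= 2 ^+ J by rewrite -discount_inv; exact: htime_le.
have sh : 0 <= \sum_y s y * h y.
  by apply: sumr_ge0 => y _; rewrite mulr_ge0 //; exact: htime_ge0.
have := mulr_ge0 e0 sh.
have : (1 - eps) * (h x - 1) <= (1 - eps) * avg p h x by rewrite ler_wpM2l ?subr_ge0.
have := ler_wpM2l e0 h2; nra.
Qed.

(** * The expected cover time as a recursion over histories *)

Definition srw (R : realType) (G : graph) (u w : G) : R :=
  if adj u w then (degree u)%:R^-1 else 0.

Lemma srw_sym_stochastic (R : realType) (G : graph) (d : nat) :
  (0 < d)%N -> regular G d -> sym_stochastic (@srw R G).
Proof.
move=> d0 Gd; split=> [x y|x y|x]; rewrite /srw ?Gd.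
- by case: ifP => _; rewrite ?invr_ge0.
- by rewrite adj_sym.
- by rewrite -big_mkcond /= sumr_const -/(degree x) Gd -[LHS]mulr_natr mulVf // pnatr_eq0 -lt0n.
Qed.

Definition unvisited (V : finType) (h : seq V) : {set V} :=
  [set u | u \notin h]%SET.

Lemma unvisited_rcons (V : finType) (h : seq V) (w : V) :
  unvisited (rcons h w) = unvisited h :\ w.
Proof. by apply/setP => u; rewrite !inE mem_rcons inE negb_or. Qed.

(** The expected number of times i < m at which the walk continuing the history
    h still misses a vertex, plus L times the probability that it does so at
    time m. The terminal term is there so that the comparison with the
    potential can start at m = 0. *)
Fixpoint uncovered_time (R : realType) (G : graph) (eps : R)
    (sigma : seq G -> G -> R) (v : G) (L : R) (m : nat) (h : seq G) : R :=
  let b := (unvisited h != finset.set0)%:R in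
  if m is m'.+1 then
    b + \sum_w tbrw_step eps sigma h (last v h) w *
          uncovered_time eps sigma v L m' (rcons h w)
  else L * b.

Lemma uncovered_time_ge0 (R : realType) (G : graph) (eps : R)
    (sigma : seq G -> G -> R) (v : G) (L : R) (m : nat) (h : seq G) (u : G) :
  is_strategy sigma -> 0 <= eps <= 1 -> 0 <= L ->
  0 <= uncovered_time eps sigma v L m (rcons h u).
Proof.
move=> ss e01 L0; elim: m h u => [|m IH] h u /=; first by rewrite mulr_ge0.
rewrite addr_ge0 //; apply: sumr_ge0 => w _; rewrite mulr_ge0 //.
by rewrite last_rcons tbrw_step_ge0.
Qed.

(** Each step with an unvisited vertex left adds 1 to the waiting time and takes
    at most 1 + eps 2^J from the potential on average. For a covering history the
    potential is at most 2^J, and for any other it is at most L. *)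
Lemma potential_le_uncovered_time (R : realType) (G : graph) (d J : nat)
    (eps : R) (sigma : seq G -> G -> R) (v : G) (L : R) (m : nat) (h : seq G)
    (u : G) :
  (0 < d)%N -> regular G d -> is_strategy sigma -> 0 <= eps <= 1 ->
  2 ^+ J + J%:R * #|G|%:R <= L ->
  potential (@srw R G) J (unvisited (rcons h u)) u <=
    (1 + eps * 2 ^+ J) * uncovered_time eps sigma v L m (rcons h u) + 2 ^+ J.
Proof.
move=> d0 Gd ss e01 LP; have sp := srw_sym_stochastic R d0 Gd.
have /andP[e0 e1] := e01.
have K0 : 0 < 2 ^+ J :> R by rewrite exprn_gt0.
have L0 : 0 <= L.
  by apply: le_trans LP; rewrite addr_ge0 ?mulr_ge0 // ltW.
have A1 : 1 <= 1 + eps * 2 ^+ J by rewrite lerDl mulr_ge0 // ltW.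
elim: m h u => [|m IH] h u; have [E|E] := eqVneq (unvisited (rcons h u)) finset.set0.
1,3: rewrite E; apply: (@le_trans _ _ (2 ^+ J)).
1,3: have := energy_set0 J sp; have := htime_le finset.set0 u sp (discount_itv R J);
  by rewrite discount_inv /potential; lra.
1,2: by rewrite lerDr; apply: (mulr_ge0 (le_trans ler01 A1)); exact: uncovered_time_ge0.
  rewrite /= E mulr1; apply: le_trans (potential_le _ _ _ sp) _.
  apply: le_trans LP _; apply: (@le_trans _ _ ((1 + eps * 2 ^+ J) * L)).
    by rewrite ler_peMl.
  by rewrite lerDl ltW.
rewrite [uncovered_time _ _ _ _ _ _]/= E last_rcons.
have [s0 _ s1] := ss h u.
have uh : u \notin unvisited (rcons h u) by rewrite inE mem_rcons inE eqxx.
have := potential_step J sp e01 s0 s1 uh.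
rewrite lerBlDl => /le_trans; apply.
rewrite mulrDr mulr1 -[leRHS]addrA lerD2l mulr_sumr.
have KE : 2 ^+ J = \sum_w tbrw_step eps sigma (rcons h u) u w * 2 ^+ J :> R.
  by rewrite -mulr_suml tbrw_step_sum // mul1r.
rewrite [X in _ <= _ + X]KE -big_split; apply: ler_sum => w _ /=.
rewrite mulrCA -mulrDr -unvisited_rcons -/(srw R u w).
apply: ler_wpM2l; last exact: IH.
exact: (tbrw_step_ge0 h u w ss e01).
Qed.

(** * The law of the walk *)

Definition cylinder (G : graph) (T : Type) (X : nat -> T -> G) (h : seq G)
    (v : G) : set T :=
  [set w | forall i, (i < size h)%N -> X i w = nth v h i].

(** The event that the cover time exceeds t. *)
Definition uncovered (G : graph) (T : Type) (X : nat -> T -> G) (t : nat) :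
    set T :=
  [set w | exists u, forall i, (i <= t)%N -> X i w <> u].

Lemma measurable_cylinder (G : graph) (disp : measure_display)
    (T : measurableType disp) (X : nat -> T -> G) (h : seq G) (v : G) :
  (forall t u, measurable (X t @^-1` [set u])) -> measurable (cylinder X h v).
Proof.
move=> mX.
have -> : cylinder X h v =
    \bigcap_(i in [set i | (i < size h)%N]) X i @^-1` [set nth v h i] by [].
by apply: bigcap_measurableType => i _; exact: mX.
Qed.

Lemma measurable_uncovered (G : graph) (disp : measure_display)
    (T : measurableType disp) (X : nat -> T -> G) (t : nat) :
  (forall t u, measurable (X t @^-1` [set u])) -> measurable (uncovered X t).
Proof.
move=> mX.
have -> : uncovered X t =
    \bigcup_(u : G) \bigcap_(i in [set i | (i <= t)%N]) ~` (X i @^-1` [set u]).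
  apply/seteqP; split=> w /=; first by move=> [u uw]; exists u.
  by move=> [u _ uw]; exists u.
apply: countable_bigcupT_measurable => // u.
by apply: bigcap_measurableType => i _; apply: measurableC; exact: mX.
Qed.

Lemma measure_preimage_sum (G : finType) (disp : measure_display)
    (T : measurableType disp) (R : realType) (P : probability T R)
    (Y : T -> G) (A : set T) :
  (forall u, measurable (Y @^-1` [set u])) -> measurable A ->
  fine (P A) = \sum_u fine (P (A `&` Y @^-1` [set u])).
Proof.
move=> mY mA.
have E : P A = (\sum_u P (A `&` Y @^-1` [set u]))%E.
  have -> : P A = P (\bigcup_(u in [set: G]) (A `&` Y @^-1` [set u])).
    congr (P _); apply/seteqP; split=> [w Aw|w [u _ []]//].
    by exists (Y w).
  rewrite measure_fin_bigcup //.
  - rewrite (@fsbigE _ _ _ _ _ (index_enum G)) ?index_enum_uniq //.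
      by apply: eq_bigl => u; rewrite in_setT.
    by move=> u _; rewrite mem_index_enum.
  - exact: finite_finset.
  - by move=> u1 u2 _ _ [w [[_ /= <-] [_ /= <-]]].
  - by move=> u _; exact: measurableI.
rewrite E sum_fine // => u _; apply: fin_num_measure.
exact: measurableI.
Qed.

Lemma cylinder_rcons (G : graph) (T : Type) (X : nat -> T -> G) (h : seq G)
    (v w : G) :
  cylinder X (rcons h w) v = cylinder X h v `&` X (size h) @^-1` [set w].
Proof.
apply/seteqP; split=> y /=; rewrite /cylinder /= size_rcons.
  move=> H; split; last by rewrite H // nth_rcons ltnn eqxx.
  by move=> i ih; rewrite H ?nth_rcons ?ih // ltnW.
move=> [H E] i; rewrite ltnS leq_eqVlt => /predU1P[->|ih].
  by rewrite E nth_rcons ltnn eqxx.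
by rewrite nth_rcons ih H.
Qed.

Lemma cylinder_uncovered (G : graph) (T : Type) (X : nat -> T -> G)
    (h : seq G) (v : G) (t : nat) :
  size h = t.+1 ->
  cylinder X h v `&` uncovered X t =
    if unvisited h != finset.set0 then cylinder X h v else set0.
Proof.
move=> ht; case: (set_0Vmem (unvisited h)) => [E|[u]].
  rewrite E eqxx /= -subset0 => w [hw [u uw]].
  have : u \notin unvisited h by rewrite E inE.
  rewrite inE negbK => /(nthP v)[i ih iu].
  by apply: (uw i); rewrite ?hw // -ltnS -ht.
move=> uh; have -> : unvisited h != finset.set0 by apply/set0Pn; exists u.
apply/setIidPl => w hw; exists u => i it.
rewrite hw ?ht //; move: uh; rewrite inE => /negP uh iu.
by apply: uh; rewrite -iu mem_nth // ht.
Qed.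

(** Induction on m: the term i = 0 depends on the history alone, and the others
    are split according to the next vertex, by the transition law. *)
Lemma sum_uncovered (R : realType) (G : graph) (eps : R)
    (sigma : seq G -> G -> R) (v : G) (disp : measure_display)
    (T : measurableType disp) (P : probability T R) (X : nat -> T -> G)
    (L : R) (m t : nat) (h : seq G) :
  is_tbrw eps sigma v P X -> size h = t.+1 ->
  \sum_(i < m) fine (P (cylinder X h v `&` uncovered X (t + i))) +
    L * fine (P (cylinder X h v `&` uncovered X (t + m))) =
  fine (P (cylinder X h v)) * uncovered_time eps sigma v L m h.
Proof.
move=> [mX X0 Xstep].
have now t' h' : size h' = t'.+1 ->
    fine (P (cylinder X h' v `&` uncovered X t')) =
    fine (P (cylinder X h' v)) * (unvisited h' != finset.set0)%:R.
  move=> ht; rewrite cylinder_uncovered //.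
  by case: ifP => _; rewrite ?mulr1 // mulr0 measure0.
have step h' w : (0 < size h')%N -> fine (P (cylinder X (rcons h' w) v)) =
    fine (P (cylinder X h' v)) * tbrw_step eps sigma h' (last v h') w.
  case E : (size h') => [//|s] _; have := Xstep s (nth v (rcons h' w)).
  have -> : [set y | forall i, (i <= s.+1)%N -> X i y = nth v (rcons h' w) i] =
      cylinder X (rcons h' w) v by rewrite /cylinder size_rcons E.
  have -> : [set y | forall i, (i <= s)%N -> X i y = nth v (rcons h' w) i] =
      cylinder X h' v.
    rewrite /cylinder E; apply/seteqP; split=> y H i iS.
      by rewrite H // nth_rcons E iS.
    by rewrite H // nth_rcons E ltnS iS.
  have -> : mkseq (nth v (rcons h' w)) s.+1 = h'.
    apply: (@eq_from_nth _ v); rewrite size_mkseq ?E // => i iS.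
    by rewrite nth_mkseq // nth_rcons E iS.
  rewrite !nth_rcons E ltnSn ltnn eqxx -(nth_last v) E => ->.
  by rewrite fineM // fin_num_measure //; exact: measurable_cylinder.
have split h' A : measurable A -> fine (P (cylinder X h' v `&` A)) =
    \sum_w fine (P (cylinder X (rcons h' w) v `&` A)).
  move=> mA; rewrite (measure_preimage_sum P (mX (size h'))); last first.
    by apply: measurableI => //; exact: measurable_cylinder.
  by apply: eq_bigr => w _; rewrite cylinder_rcons setIAC.
elim: m t h => [|m IH] t h ht /=.
  by rewrite big_ord0 add0r addn0 now // mulrCA.
rewrite big_ord_recl /= addn0 now // mulrDr -addrA; congr (_ + _).
rewrite split; last exact: measurable_uncovered.
rewrite (eq_bigr (fun i : 'I_m => \sum_w
    fine (P (cylinder X (rcons h w) v `&` uncovered X (t.+1 + i))))); last first.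
  by move=> i _; rewrite /bump add1n -addSnnS split //; exact: measurable_uncovered.
rewrite exchange_big /= mulr_sumr mulr_sumr -big_split /=.
apply: eq_bigr => w _; rewrite mulrA -step ?ht // -(IH t.+1) ?size_rcons ?ht //.
by rewrite addSnnS.
Qed.

(** The integral of a nonnegative function is the supremum over the simple
    functions below it, hence monotone without measurability; this avoids
    proving that the cover time is measurable. *)
Lemma le_integral_of_le (d : measure_display) (T : measurableType d)
    (R : realType) (mu : {measure set T -> \bar R}) (f g : T -> \bar R) :
  (forall x, 0 <= f x)%E -> (forall x, f x <= g x)%E ->
  (\int[mu]_x f x <= \int[mu]_x g x)%E.
Proof.
move=> f0 fg; have g0 x : (0 <= g x)%E by apply: le_trans (fg x).
rewrite !ge0_integralTE //; apply: le_ereal_sup => _ [h hf <-].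
by exists h => // x; apply: le_trans (fg x); exact: hf.
Qed.

(** The cover time is at least the number of times t < m at which a vertex is
    still missing. *)
Lemma integral_cover_time_ge (R : realType) (G : graph)
    (disp : measure_display) (T : measurableType disp) (P : probability T R)
    (X : nat -> T -> G) (m : nat) :
  (forall t u, measurable (X t @^-1` [set u])) ->
  ((\sum_(t < m) fine (P (uncovered X t)))%:E <=
    \int[P]_w cover_time R X w)%E.
Proof.
move=> mX; have mU t := measurable_uncovered t mX.
have -> : (\sum_(t < m) fine (P (uncovered X t)))%:E =
    (\int[P]_w (\sum_(t < m) (\1_(uncovered X t) w)%:E)%E)%E :> \bar R.
  rewrite ge0_integral_sum //; last first.
  - by move=> t; apply/measurable_EFinP; exact: measurable_indic.
  rewrite -sumEFin; apply: eq_bigr => t _.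
  by rewrite integral_indic // setIT fineK // fin_num_measure.
apply: le_integral_of_le => w; first by apply: sume_ge0 => t _; rewrite lee_fin.
apply: le_ereal_inf_tmp => _ [t /= tc <-].
rewrite sumEFin lee_fin.
have hit i : (t <= i)%N -> \1_(uncovered X i) w = 0 :> R.
  move=> ti; rewrite indicE; suff -> : w \in uncovered X i = false by [].
  apply/negP; rewrite inE => -[u uw]; have [j jt ju] := tc u.
  by apply: (uw j) => //; exact: leq_trans jt ti.
apply: (@le_trans _ _ (minn m t)%:R); last by rewrite ler_nat geq_minr.
elim: m => [|m IH]; first by rewrite big_ord0.
rewrite big_ord_recr /=; have [tm|mt] := leqP t m.
  by rewrite hit // addr0 (le_trans IH) // ler_nat; lia.
have -> : (minn m.+1 t)%:R = (minn m t)%:R + 1 :> R.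
  by rewrite natr1; congr (_%:R); lia.
by rewrite lerD // indicE; case: (_ \in _).
Qed.

(** * The lower bound on the cover time *)

Lemma C_TB_ge (R : realType) (G : graph) (d J : nat) (eps : R) (v : G) :
  (0 < d)%N -> regular G d -> 0 <= eps <= 1 -> eps * 2 ^+ J <= 1 ->
  (((J%:R * #|G|%:R / 6 - 2 ^+ J) / 4)%:E <= C_TB eps v)%E.
Proof.
move=> d0 Gd e01 eK; apply: le_ereal_inf_tmp.
move=> _ [sigma [disp [T [P [X [ss tbrw ->]]]]]].
have [mX X0 _] := tbrw; have sp := srw_sym_stochastic R d0 Gd.
pose m := (2 ^ J + J * #|G|)%N; pose S := \sum_(t < m) fine (P (uncovered X t)).
have mE : m%:R = 2 ^+ J + J%:R * #|G|%:R :> R by rewrite natrD natrM natrX.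
apply: le_trans (integral_cover_time_ge _ m mX); rewrite lee_fin -/S.
have prS (A B : set T) : measurable A -> measurable B -> A `<=` B ->
    fine (P A) <= fine (P B).
  move=> mA mB AB; rewrite fine_le ?fin_num_measure //.
  by apply: le_measure; rewrite ?inE.
have mU t := measurable_uncovered t mX.
have mC h := measurable_cylinder h v mX.
(* The probabilities of being uncovered decrease in time, so the one at time m
   taken m times is at most the sum S of the first m: the terminal term with
   L = m only doubles the bound. *)
have UB : uncovered_time eps sigma v m%:R m [:: v] <= 2 * S.
  have := sum_uncovered m%:R m tbrw (erefl : size [:: v] = 1%N).
  have -> : cylinder X [:: v] v = X 0%N @^-1` [set v].
    by apply/seteqP; split=> w H; [exact: (H 0%N isT)|move=> [|//] _; exact: H].
  rewrite X0 mul1r => <-.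
  have -> : 2 * S = S + S by ring.
  apply: lerD.
    by apply: ler_sum => i _; apply: prS => //; exact: measurableI.

  rewrite mulr_natl -[X in _ *+ X]card_ord -sumr_const; apply: ler_sum => i _.
  apply: prS => //; first exact: measurableI.
  move=> w [_ [u uw]]; exists u => j ji; apply: uw.
  by rewrite add0n (leq_trans ji) // ltnW.
have WB : J%:R * #|G|%:R / 6 <= potential (@srw R G) J (unvisited [:: v]) v.
  rewrite -(energy_setT J sp).
  have -> : unvisited [:: v] = [set: G]%SET :\ v by apply/setP => u; rewrite !inE andbT.
  by apply: le_trans (potential_setD1 _ _ _ sp); rewrite lerDr htime_ge0 ?discount_itv.
have e0 : 0 <= eps by case/andP: e01.
have mle : 2 ^+ J + J%:R * #|G|%:R <= m%:R :> R by rewrite mE.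
have := potential_le_uncovered_time v m [::] v d0 Gd ss e01 mle.
have := uncovered_time_ge0 v m [::] v ss e01 (ler0n R m).
rewrite /=; move: UB WB eK.
set ut := uncovered_time _ _ _ _ _ _; set K := 2 ^+ J.
set a := J%:R * _ / _; set b := potential _ _ _ _.
by move=> *; nra.
Qed.

Lemma tcov_TB_ge (R : realType) (G : graph) (d J : nat) (eps : R) :
  (0 < d)%N -> regular G d -> 0 <= eps <= 1 -> eps * 2 ^+ J <= 1 ->
  (((J%:R * #|G|%:R / 6 - 2 ^+ J) / 4)%:E <= tcov_TB G eps)%E.
Proof.
move=> d0 Gd e01 eK; have /card_gt0P[v _] := graph_nonempty G.
apply: le_trans (C_TB_ge v d0 Gd e01 eK) _; rewrite /tcov_TB.
exact: (le_bigmax _ (fun v => C_TB eps v) v).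
Qed.

(** The number J of scales is chosen so that J / 24 exceeds 2 C. Since
    ln d >= ln 2, the choice c = (ln 2)^2 / 2^J makes eps 2^J <= 1, and for
    graphs with at least 2^J vertices the additive constant is at most n. *)
Lemma tcov_TB_ge_linear (R : realType) (C : R) :
  1 <= C ->
  exists c : R, 0 < c /\
  exists n0 : nat,
    forall (G : graph) (d : nat) (eps : R),
      (n0 <= #|G|)%N -> (2 <= d)%N -> regular G d ->
      0 <= eps <= 1 -> eps <= c / (ln d%:R) ^+ 2 ->
      ((C * #|G|%:R)%:E <= tcov_TB G eps)%E.
Proof.
move=> C1; pose q := (Num.truncn C).+1; pose J := (48 * q)%N.
have Cq : C <= q%:R by rewrite ltW // truncnS_gt.
have K0 : 0 < 2 ^+ J :> R by rewrite exprn_gt0.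
have l2 : 0 < ln (2 : R) by rewrite ln_gt0 // ltr1n.
exists (ln 2 ^+ 2 / 2 ^+ J); split; first by rewrite divr_gt0 ?exprn_gt0.
exists (2 ^ J)%N => G d eps nG d2 Gd e01 ec.
have eK : eps * 2 ^+ J <= 1.
  have ld : ln (2 : R) <= ln d%:R by rewrite ler_ln ?posrE ?ltr0n ?ler_nat //; lia.
  have ld0 : 0 < ln (d%:R : R) by exact: lt_le_trans ld.
  rewrite -ler_pdivlMr // mul1r; apply: le_trans ec _.
  rewrite mulrAC ler_piMl ?invr_ge0 ?(ltW K0) //.
  by rewrite ler_pdivrMr ?exprn_gt0 // mul1r ler_sqr ?nnegrE ?(ltW l2) ?(ltW ld0).
apply: le_trans (tcov_TB_ge (ltnW d2) Gd e01 eK); rewrite lee_fin.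
have Kn : 2 ^+ J <= #|G|%:R :> R by rewrite -natrX ler_nat.
have -> : J%:R = 48 * q%:R :> R by rewrite -natrM.
have := ler_wpM2r (ler0n R #|G|) C1; have := ler_wpM2r (ler0n R #|G|) Cq; lra.
Qed.

Theorem theorem1p6 (R : realType) :
  (forall C : R, 1 <= C ->
     exists c : R, 0 < c /\
     exists n0 : nat,
       forall (G : graph) (d : nat) (eps : R),
         (n0 <= #|G|)%N -> (2 <= d)%N -> regular G d ->
         0 <= eps <= 1 -> eps <= c / (ln d%:R) ^+ 2 ->
         ((C * #|G|%:R)%:E <= tcov_TB G eps)%E)
  /\
  (forall (G : nat -> graph) (d : nat -> nat) (eps : nat -> R),
     (fun k => #|G k|) @ \oo --> \oo ->
     (forall k, (2 <= d k)%N) ->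
     (forall k, regular (G k) (d k)) ->
     (forall k, 0 <= eps k <= 1) ->
     eps =o_\oo (fun k => ((ln (d k)%:R) ^+ 2)^-1 : R) ->
     (tcov_TB (G k) (eps k) * ((#|G k|%:R)^-1)%:E)%E @[k --> \oo] --> +oo%E).
Proof.
split=> [C|G d eps Ginf d2 Gd e01 eo]; first exact: tcov_TB_ge_linear.
apply/cvgeyPge => A.
have A1 : 1 <= Num.max A 1 by rewrite le_max lexx orbT.
have [c [c0 [n0 H]]] := tcov_TB_ge_linear A1.
have /eqoP/(_ c c0) ev := eo.
have /cvgnyPge/(_ n0) Gev := Ginf.
near=> k.
have n1 : 0 < #|G k|%:R :> R by rewrite ltr0n graph_nonempty.
have ek : eps k <= c / ln (d k)%:R ^+ 2.
  have : `|eps k| <= c * `|(ln (d k)%:R ^+ 2)^-1| by near: k.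
  have /andP[e0 _] := e01 k.
  by rewrite ger0_norm // ger0_norm // invr_ge0 sqr_ge0.
have nk : (n0 <= #|G k|)%N by near: k.
have := H (G k) (d k) (eps k) nk (d2 k) (Gd k) (e01 k) ek.
move=> /(lee_wpmul2r (_ : (0 <= (#|G k|%:R^-1)%:E)%E)) h.
apply: le_trans (h _); last by rewrite lee_fin invr_ge0 ltW.
by rewrite -EFinM mulfK ?gt_eqF // lee_fin le_max lexx.
Unshelve. all: by end_near.
Qed.
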